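(* Consider the system $(K,L,N_B,N_U,d_s)$ of the context with $K\ge2$, $L\ge2$, $d_s\ge 1$, $N_B=((K-1)L+1)d_s$ and $N_U=\lceil\frac{L-1}{L}N_B+\frac1L d_s\rceil$, with the cyclic assignment in which cell $k$ aligns its interference at cell $k+1$ (indices modulo $K$). Then, almost surely with respect to the channel realization, among all GIA transceivers under the uniform power allocation policy, the achievable rate $$R_{i,k}=\log_2\det\Big(\boldsymbol I_{d_s}+\tfrac1{\sigma_k^2}\boldsymbol U_{i,k}^H\boldsymbol H_{i,k}^k\boldsymbol V_{i,k}\boldsymbol V_{i,k}^H(\boldsymbol H_{i,k}^{k})^H\boldsymbol U_{i,k}\Big)$$ of each user $(i,k)$ is maximized by $$\boldsymbol V_{i,k}=\sqrt{\tfrac{P_{i,k}}{d_s}}\;\boldsymbol T_i\boldsymbol V_k^{in}\big((\boldsymbol V_k^{in})^H\boldsymbol T_i^H\boldsymbol T_i\boldsymbol V_k^{in}\big)^{-1/2},\qquad \boldsymbol U_{i,k}=\big(\boldsymbol F_{i,k}^{IA,k-1}\big)^{\perp},$$ where $\boldsymbol T_i$, $\boldsymbol V_k^{in}$ and $\boldsymbol F_{i,k}^{IA,k-1}$ are defined in the context.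
   Context: System: there are $K$ cells, each with one base station (BS) having $N_B$ antennas and $L$ users having $N_U$ antennas each; user $i$ of cell $k$ is $(i,k)$, with power budget $P_{i,k}>0$; the noise variance at BS $k$ is $\sigma_k^2>0$. The channel from user $(i,k)$ to BS $\ell$ is $\boldsymbol H_{i,k}^{\ell}=\sqrt{\eta_{i,k}^{\ell}}\,\overline{\boldsymbol H}_{i,k}^{\ell}\in\mathbb C^{N_B\times N_U}$, with $\eta_{i,k}^\ell>0$ deterministic and the $\overline{\boldsymbol H}_{i,k}^{\ell}$ mutually independent with i.i.d. standard complex Gaussian entries (Rayleigh fading). Cell indices are taken modulo $K$. Notation: for a matrix $\boldsymbol X$, $\boldsymbol X^{\perp}$ denotes a matrix whose columns form an orthonormal basis of the left null space of $\boldsymbol X$ (eigenvectors of $\boldsymbol X\boldsymbol X^H$ with eigenvalue zero), so $(\boldsymbol X^\perp)^H\boldsymbol X=\boldsymbol 0$. $\mathrm{Span}\{\boldsymbol X\}$ is the column space. GIA transceiver under uniform power allocation: a family of precoders $\boldsymbol V_{i,k}\in\mathbb C^{N_U\times d_s}$ and decoders $\boldsymbol U_{i,k}\in\mathbb C^{N_B\times d_s}$, for all $1\le i\le L$, $1\le k\le K$, such that - (alignment) $\mathrm{Span}\{\boldsymbol H_{1,k}^{k+1}\boldsymbol V_{1,k}\}=\cdots=\mathrm{Span}\{\boldsymbol H_{L,k}^{k+1}\boldsymbol V_{L,k}\}$ for every $k$; - (uniform power over the $d_s$ streams) $\boldsymbol V_{i,k}^H\boldsymbol V_{i,k}=\frac{P_{i,k}}{d_s}\boldsymbol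 I_{d_s}$; - (normalized decoders) $\boldsymbol U_{i,k}^H\boldsymbol U_{i,k}=\boldsymbol I_{d_s}$; - (interference nulling) $\boldsymbol U_{i,k}^H\boldsymbol H_{j,k}^k\boldsymbol V_{j,k}=\boldsymbol 0$ for $j\neq i$, and $\boldsymbol U_{i,k}^H\boldsymbol H_{m,\ell}^k\boldsymbol V_{m,\ell}=\boldsymbol 0$ for all $\ell\ne k$ and all $m$; - (rank) $\mathrm{rank}(\boldsymbol U_{i,k}^H\boldsymbol H_{i,k}^k\boldsymbol V_{i,k})=d_s$. Definitions used in the formula: - $\boldsymbol T_i=[\boldsymbol 0_{N_U\times(i-1)N_U},\boldsymbol I_{N_U},\boldsymbol 0_{N_U\times(L-i)N_U}]$. - $\boldsymbol A_k^{k+1}\in\mathbb C^{(L-1)N_B\times LN_U}$ is the block matrix whose $r$-th block row ($r=1,\dots,L-1$) has $\boldsymbol H_{1,k}^{k+1}$ in block column $1$, $-\boldsymbol H_{r+1,k}^{k+1}$ in block column $r+1$, and zeros elsewhere. - $\boldsymbol V_k^{in}=\big((\boldsymbol A_k^{k+1})^H\big)^{\perp}$, i.e. an orthonormal basis of the null space of $\boldsymbol A_k^{k+1}$. - With the $\boldsymbol V_{i,k}$ given by the formula of the claim: $\boldsymbol F_{i,k}^{IUI}=[\boldsymbol H_{j,k}^k\boldsymbol V_{j,k}]_{j\ne i}$, $\boldsymbol F_\ell^k=[\boldsymbol H_{1,\ell}^k\boldsymbol V_{1,\ell},\dots,\boldsymbol H_{L,\ell}^k\boldsymbol V_{L,\ell}]$,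 and $\overline{\boldsymbol F}_{k-1}^k$ is an $N_B\times d_s$ matrix whose columns form a basis of the common subspace $\mathrm{Span}\{\boldsymbol H_{1,k-1}^{k}\boldsymbol V_{1,k-1}\}=\cdots=\mathrm{Span}\{\boldsymbol H_{L,k-1}^{k}\boldsymbol V_{L,k-1}\}$. - $\boldsymbol F_{i,k}^{IA,k-1}=\big[\boldsymbol F_{i,k}^{IUI},\ \{\boldsymbol F_\ell^k\}_{\ell\ne k,\,k-1},\ \overline{\boldsymbol F}_{k-1}^k\big]$. *)

(* Defs.v *)
From mathcomp Require Import all_boot all_order all_algebra.
From mathcomp Require Import all_classical all_reals all_analysis.
From mathcomp Require Import complex.
Set Implicit Arguments.
Unset Strict Implicit.
Unset Printing Implicit Defensive.
Import Order.TTheory GRing.Theory Num.Theory.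
Local Open Scope ring_scope.
Local Open Scope complex_scope.
Local Open Scope sesquilinear_scope.

(* Users and cells are numbered from 0; user i of cell k is (i, k).           *)
(* [H i k l] is the channel from user (i, k) to the base station of cell l,   *)
(* [ordS k] and [ord_pred k] are k + 1 and k - 1 modulo K,                    *)
(* and [M^t*] is the conjugate transpose.                                     *)

Definition channels (R : realType) (K L NB NU : nat) :=
  'I_L -> 'I_K -> 'I_K -> 'M[R[i]]_(NB, NU).
Definition precoders (R : realType) (K L NU ds : nat) :=
  'I_L -> 'I_K -> 'M[R[i]]_(NU, ds).
Definition decoders (R : realType) (K L NB ds : nat) :=
  'I_L -> 'I_K -> 'M[R[i]]_(NB, ds).

(* The mxalgebra comparison concerns row spaces, hence the transposes.        *)
Definition same_span (R : realType) (m n p : nat)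
    (X : 'M[R[i]]_(m, n)) (Y : 'M[R[i]]_(m, p)) : bool :=
  (X^T == Y^T)%MS.

(* "Y = X^perp": a column y lies in the left null space of X when             *)
(* y^H X = 0, i.e. when the row y^H lies in [kermx X]. The number p of        *)
(* columns is thereby forced to be the dimension of that null space.          *)
Definition is_perp (R : realType) (m n p : nat)
    (X : 'M[R[i]]_(m, n)) (Y : 'M[R[i]]_(m, p)) : Prop :=
  Y^t* *m Y = 1%:M /\ (Y^t* == kermx X)%MS.

(* M^{-1/2} by functional calculus: [spectralmx M] is unitary and, for M      *)
(* normal, M = (spectralmx M)^H diag(spectral_diag M) (spectralmx M).         *)
(* Meaningful only for M Hermitian positive definite.                         *)
Definition mxinvsqrt (R : realType) (n : nat) (M : 'M[R[i]]_n) : 'M[R[i]]_n :=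
  (spectralmx M)^t*
    *m diag_mx (map_mx (fun x => (sqrtC x)^-1) (spectral_diag M))
    *m spectralmx M.

Definition mutually_independent (d : measure_display) (Omega : measurableType d)
    (R : realType) (P : probability Omega R) (I : finType)
    (X : I -> {RV P >-> R}) : Prop :=
  forall (J : {set I}) (B : I -> set R), (forall j, measurable (B j)) ->
    P (\bigcap_(j in [set` J]) (X j @^-1` B j))%classic
    = (\prod_(j in J) P (X j @^-1` B j)%classic)%E.

(* Each complex Gaussian entry has unit variance, so its real and imaginary   *)
(* parts are N(0, 1/2); the second parameter of [normal_prob] is the standard *)
(* deviation. The boolean selects the real (false) or imaginary (true) part.  *)
Definition fading_index (K L NB NU : nat) : finType :=
  ('I_L * 'I_K * 'I_K * 'I_NB * 'I_NU * bool)%type.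

Definition rayleigh_fading (d : measure_display) (Omega : measurableType d)
    (R : realType) (P : probability Omega R) (K L NB NU : nat)
    (G : fading_index K L NB NU -> {RV P >-> R}) : Prop :=
  (forall t (B : set R), measurable B ->
     distribution P (G t) B = normal_prob 0 (Num.sqrt 2^-1) B)
  /\ mutually_independent G.

Definition rayleigh_channel (R : realType) (K L NB NU : nat)
    (eta : 'I_L -> 'I_K -> 'I_K -> R) (g : fading_index K L NB NU -> R) :
    channels R K L NB NU :=
  fun i k l => (Num.sqrt (eta i k l))%:C *:
    \matrix_(a, b) (g (i, k, l, a, b, false) +i* g (i, k, l, a, b, true)).

Definition is_GIA_transceiver (R : realType) (K L NB NU ds : nat)
    (H : channels R K L NB NU) (pw : 'I_L -> 'I_K -> R)
    (V : precoders R K L NU ds) (U : decoders R K L NB ds) : Prop :=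
  [/\ forall k i j,
        same_span (H i k (ordS k) *m V i k) (H j k (ordS k) *m V j k),
      forall i k, (V i k)^t* *m V i k = ((pw i k / ds%:R)%:C)%:M,
      forall i k, (U i k)^t* *m U i k = 1%:M,
      (forall i j k, j != i -> (U i k)^t* *m H j k k *m V j k = 0)
      /\ (forall i k m l, l != k -> (U i k)^t* *m H m l k *m V m l = 0)
    & forall i k, \rank ((U i k)^t* *m H i k k *m V i k) = ds].

Definition rate (R : realType) (K L NB NU ds : nat)
    (H : channels R K L NB NU) (sigma2 : 'I_K -> R)
    (V : precoders R K L NU ds) (U : decoders R K L NB ds)
    (i : 'I_L) (k : 'I_K) : R :=
  (* The determinant is a positive real number embedded in R[i]. *)
  ln (complex.Re (\det (1%:M + ((sigma2 k)^-1)%:C *: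
        ((U i k)^t* *m H i k k *m V i k
           *m (V i k)^t* *m (H i k k)^t* *m U i k)))) / ln 2.

Definition T_mx (R : realType) (L NU : nat) (i : 'I_L) :
    'M[R[i]]_(NU, \sum_(c < L) NU) :=
  \mxrow_(c < L) (if c == i then 1%:M else 0 : 'M[R[i]]_NU).

(* Block row r (from 0) is [H_0, 0, .., 0, - H_(r+1), 0, .., 0].              *)
Definition A_mx (R : realType) (K L NB NU : nat) (H : channels R K L NB NU)
    (k : 'I_K) : 'M[R[i]]_(\sum_(r < L.-1) NB, \sum_(c < L) NU) :=
  \mxblock_(r < L.-1, c < L)
    (if c == 0%N :> nat then H c k (ordS k)
     else if c == r.+1 :> nat then - H c k (ordS k)
     else 0 : 'M[R[i]]_(NB, NU)).

Definition gram_in (R : realType) (L NU ds : nat)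
    (Vin : 'M[R[i]]_(\sum_(c < L) NU, ds)) (i : 'I_L) : 'M[R[i]]_ds :=
  Vin^t* *m (T_mx R NU i)^t* *m T_mx R NU i *m Vin.

Definition F_IUI (R : realType) (K L NB NU ds : nat)
    (H : channels R K L NB NU) (V : precoders R K L NU ds)
    (i : 'I_L) (k : 'I_K) : 'M[R[i]]_(NB, \sum_(j < L.-1) ds) :=
  \mxrow_(j < L.-1) (H (lift i j) k k *m V (lift i j) k).

Definition F_cell (R : realType) (K L NB NU ds : nat)
    (H : channels R K L NB NU) (V : precoders R K L NU ds)
    (l k : 'I_K) : 'M[R[i]]_(NB, \sum_(m < L) ds) :=
  \mxrow_(m < L) (H m l k *m V m l).

Definition other_cells (K : nat) (k : 'I_K) : {set 'I_K} :=
  [set l | (l != k) && (l != ord_pred k)].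

Definition F_IA (R : realType) (K L NB NU ds : nat)
    (H : channels R K L NB NU) (V : precoders R K L NU ds)
    (Fbar : 'I_K -> 'M[R[i]]_(NB, ds)) (i : 'I_L) (k : 'I_K) :
    'M[R[i]]_(NB, \sum_(j < L.-1) ds
       + \sum_(t < #|other_cells k|) \sum_(m < L) ds + ds) :=
  row_mx (row_mx (F_IUI H V i k)
            (\mxrow_(t < #|other_cells k|) F_cell H V (enum_val t) k))
         (Fbar k).

(* V and U are given by the closed formulas, for the choices [Vin k] of       *)
(* V_k^in and [Fbar k] of a basis of the span of the aligned interference     *)
(* received in cell k from cell k - 1.                                        *)
Definition is_closed_form (R : realType) (K L NB NU ds : nat)
    (H : channels R K L NB NU) (pw : 'I_L -> 'I_K -> R)
    (Vin : 'I_K -> 'M[R[i]]_(\sum_(c < L) NU, ds))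
    (Fbar : 'I_K -> 'M[R[i]]_(NB, ds))
    (V : precoders R K L NU ds) (U : decoders R K L NB ds) : Prop :=
  [/\ forall k, is_perp ((A_mx H k)^t*) (Vin k),
      forall i k, V i k = (Num.sqrt (pw i k / ds%:R))%:C *:
        (T_mx R NU i *m Vin k *m mxinvsqrt (gram_in (Vin k) i)),
      forall k, \rank (Fbar k) = ds
        /\ (forall i, same_span (Fbar k)
                        (H i (ord_pred k) k *m V i (ord_pred k)))
    & forall i k, is_perp (F_IA H V Fbar i k) (U i k)].

(* Main.v *)
From HB Require Import structures.
Require Import Defs.
From mathcomp Require Import all_boot all_order all_algebra.
From mathcomp Require Import all_classical all_reals all_analysis.
From mathcomp Require Import complex measurable_realfun zify ring.

(* Here N_U = ((L-1)(K-1)+1) d_s exactly, so for a generic channel the kernel *)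
(* of A_k^(k+1) has dimension d_s. Alignment forces the columns of any family *)
(* of admissible precoders, suitably recombined, into that kernel; hence      *)
(* V' = V Q for every competitor, and the uniform power constraint makes Q    *)
(* unitary. Likewise the null space of F^IA has dimension d_s and U' = U D    *)
(* with D unitary. The rate does not see Q and D, so all GIA transceivers     *)
(* achieve the same rate.                                                     *)
(* Genericity amounts to the nonvanishing of Gram determinants, which are     *)
(* polynomials in the real and imaginary parts of the channel coefficients.   *)
(* Such a polynomial is almost surely nonzero as soon as it is nonzero at one *)
(* point: the coordinates of that point are made random one after the other,  *)
(* and at each step a nonzero univariate polynomial avoids its finitely many  *)
(* roots almost surely. The point is a channel made of coordinate inclusions. *)

Set Implicit Arguments.
Unset Strict Implicit.
Unset Printing Implicit Defensive.
Import Order.TTheory GRing.Theory Num.Theory.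
Local Open Scope ring_scope.

(** * Polynomials in independent atomless random variables *)

(** Over a channel satisfying [generic_channels] no optimization is left. Since L N_U - (L-1) N_B =
    d_s, alignment confines the precoders of a cell to one d_s-dimensional kernel, and they are
    unique up to a right unitary factor ([aligned_V]). Once a single d_s-column block stands for all
    L users of cell k-1, the interference fills (K-1) L d_s = N_B - d_s columns, and the decoders
    are unique up to a unitary as well ([perp_span], [closed_U_exists]). By [rate_invariant] neither
    factor changes the rate, so [closed_form_optimal] is an equality; [closed_form_exists] gives
    existence. Almost sure genericity is [generic_channels_ae]: [generic_of_gram] reduces it to
    determinants, [polyfun_neq0_ae] asks for one point where each is nonzero, and [config] supplies
    that point. *)

Inductive polyfun (I : Type) (R : nzRingType) : ((I -> R) -> R) -> Prop :=
| polyfun_cst c : polyfun (fun _ => c)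
| polyfun_coord t : polyfun (fun g => g t)
| polyfunD f h : polyfun f -> polyfun h -> polyfun (fun g => f g + h g)
| polyfunM f h : polyfun f -> polyfun h -> polyfun (fun g => f g * h g).

Lemma polyfun_line (I : eqType) (R : comNzRingType) (f : (I -> R) -> R) (g : I -> R) t :
  polyfun f ->
  exists q : {poly R}, forall y, f (fun s => if s == t then y else g s) = q.[y].
Proof.
elim=> [c|s|f1 f2 _ [q1 E1] _ [q2 E2]|f1 f2 _ [q1 E1] _ [q2 E2]].
- by exists c%:P => y; rewrite hornerC.
- have [st|st] := eqVneq s t; first by exists 'X => y; rewrite hornerX.
  by exists (g s)%:P => y; rewrite hornerC.
- by exists (q1 + q2) => y; rewrite hornerD E1 E2.
- by exists (q1 * q2) => y; rewrite hornerM E1 E2.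
Qed.

Lemma measurable_polyfun (I : Type) (R : realType) d (T : measurableType d)
    (f : (I -> R) -> R) (phi : I -> T -> R) :
  polyfun f -> (forall t, measurable_fun setT (phi t)) ->
  measurable_fun setT (fun w => f (phi^~ w)).
Proof.
move=> pf mphi; elim: pf => [c|s|f1 f2 _ m1 _ m2|f1 f2 _ m1 _ m2].
- exact: measurable_cst.
- exact: mphi.
- exact: measurable_funD.
- exact: measurable_funM.
Qed.

Section Independence.
Context d (Omega : measurableType d) (R : realType) (P : probability Omega R).
Variables (I : finType) (X : I -> {RV P >-> R}).
Hypothesis indepX : mutually_independent X.
Local Open Scope classical_set_scope.

(** A pi-system generating the sigma-algebra of the coordinates in [J]. *)
Definition cylinders (J : {set I}) : set (set Omega) :=
  [set A | exists2 B : I -> set R, (forall j, measurable (B j))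
     & A = \bigcap_(j in [set` J]) (X j @^-1` B j)].

Lemma measurable_preim t (B : set R) : measurable B -> measurable (X t @^-1` B).
Proof. exact: measurable_funPTI. Qed.

Lemma cylinders_measurable J : cylinders J `<=` measurable.
Proof.
move=> _ [B mB ->]; apply: fin_bigcap_measurable => // j _.
exact: measurable_preim.
Qed.

Lemma cylindersT J : cylinders J setT.
Proof. by exists (fun=> setT) => //; apply/esym; rewrite -subTset => w _ j _. Qed.

Lemma cylindersI J : setI_closed (cylinders J).
Proof.
move=> _ _ [B mB ->] [B' mB' ->]; exists (fun j => B j `&` B' j).
  by move=> j; exact: measurableI.
by rewrite -bigcapI.
Qed.

Lemma sigma_cylinders_measurable J (A : set Omega) :
  <<s cylinders J >> A -> measurable A.
Proof.
apply: smallest_sub => //; first exact: sigma_algebra_measurable.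
exact: cylinders_measurable.
Qed.

(** Both sides are finite measures in [A]. They agree on cylinders by independence over [t |: J],
    hence on the sigma-algebra that this pi-system generates. *)
Lemma indep_sigma (J : {set I}) t (A : set Omega) (B : set R) :
  t \notin J -> <<s cylinders J >> A -> measurable B ->
  P (A `&` X t @^-1` B) = (P A * P (X t @^-1` B))%E.
Proof.
move=> tJ sA mB; have mXB := measurable_preim t mB.
have PB_fin : P (X t @^-1` B) \is a fin_num by exact: fin_num_measure.
pose r := NngNum (fine_ge0 (measure_ge0 P (X t @^-1` B))).
have mscaleE E : mscale r P E = (P E * P (X t @^-1` B))%E.
  by rewrite /mscale /= fineK // muleC.
rewrite -mscaleE.
have -> : P (A `&` X t @^-1` B) = mrestr P mXB A by [].
apply: (g_sigma_algebra_measure_unique (cylinders J) (@cylinders_measurable J)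
  (fun=> setT)) sA => //.
- by move=> _; exact: cylindersT.
- by rewrite bigcup_const.
- exact: cylindersI.
- move=> _ [C mC ->]; apply: etrans (esym (mscaleE _)); rewrite /= /mrestr.
  pose C' j := if j == t then B else C j.
  have mC' j : measurable (C' j) by rewrite /C'; case: eqP.
  have := indepX (t |: J) mC'.
  rewrite big_setU1 //= {2}/C' eqxx.
  have -> : (\prod_(j in J) P (X j @^-1` C' j) = \prod_(j in J) P (X j @^-1` C j))%E.
    apply: eq_bigr => j jJ; rewrite /C'; case: eqP => // jt.
    by rewrite -jt jJ in tJ.
  rewrite -indepX // muleC => <-; congr (P _).
  apply/seteqP; split=> w /=.
    move=> [Cw Bw] j /=; rewrite in_setU1 /C'; case: eqP => [-> //|_ /= jJ].
    exact: Cw.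
  move=> C'w; split=> [j /= jJ|].
    have := C'w j; rewrite /= in_setU1 jJ orbT /C' => /(_ isT).
    by case: eqP => // jt; rewrite -jt jJ in tJ.
  by have := C'w t; rewrite /= in_setU1 eqxx /C' eqxx; apply.
- by move=> _; rewrite /= /mrestr setTI ltey_eq fin_num_measure.
Qed.

Hypothesis atomlessX : forall t y, P (X t @^-1` [set y]) = 0%E.

(** Induction on the size: one root is split off at a time, and each root is hit with probability
    zero. *)
Lemma poly_root_negligible t (q : {poly R}) :
  q != 0 -> P.-negligible (X t @^-1` [set y | q.[y] = 0]).
Proof.
elim: (size q) {-2}q (leqnn (size q)) => {q} [q|n IHn q].
  by rewrite leqn0 size_poly_eq0 => ->.
move=> sq q0; have [[a qa]|noroot] := pselect (exists a, root q a); last first.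
  apply: negligibleS (negligible_set0 P) => w /= qw.
  by apply: noroot; exists (X t w); apply/rootP.
have /factor_theorem[p qE] := qa.
have p0 : p != 0 by apply: contraNneq q0 => p0; rewrite qE p0 mul0r.
have Xa : P.-negligible (X t @^-1` [set a]).
  by apply/negligibleP; [exact: measurable_preim|exact: atomlessX].
apply: negligibleS (negligibleU Xa (IHn p _ p0)).
  move=> w /=; rewrite qE hornerM hornerXsubC => /eqP.
  by rewrite mulf_eq0 subr_eq0 => /orP[]/eqP; [right|left].
rewrite -ltnS (leq_trans _ sq) // qE.
by rewrite size_Mmonic ?monicXsubC // size_XsubC addn2.
Qed.

Section Fubini.
Variables (J : {set I}) (t : I).
Hypothesis tJ : t \notin J.

(** The sample space with the coarser sigma-algebra of the coordinates in [J]. It serves as the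
    first factor of a product, so Fubini applies without building a space of coordinate vectors. *)
Let OmegaJ := g_sigma_algebraType (cylinders J).

Let measurable_idJ : measurable_fun setT (id : Omega -> OmegaJ).
Proof. by move=> _ A mA; rewrite setTI; exact: sigma_cylinders_measurable mA. Qed.

Lemma measurable_coordJ s : s \in J -> measurable_fun setT (X s : OmegaJ -> R).
Proof.
move=> sJ _ B mB; rewrite setTI; apply: sub_sigma_algebra.
exists (fun j => if j == s then B else setT) => [j|]; first by case: eqP.
apply/seteqP; split=> w /= => [Bw j _|]; first by case: eqP => [->|].
by move=> /(_ s sJ); rewrite /= eqxx.
Qed.

Let idJ : {mfun Omega >-> OmegaJ} :=
  HB.pack (id : Omega -> OmegaJ) (isMeasurableFun.Build _ _ _ _ _ measurable_idJ).

Let pair_fun (w : Omega) : OmegaJ * R := (w, X t w).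

Let measurable_pairJ : measurable_fun setT pair_fun.
Proof. exact: (@measurable_fun_pair _ _ _ Omega OmegaJ R id). Qed.

Let pairJ : {mfun Omega >-> (OmegaJ * R)%type} :=
  HB.pack pair_fun (isMeasurableFun.Build _ _ _ _ _ measurable_pairJ).

(** By [indep_sigma] the joint law of [idJ] and [X t] is a product measure; the probability is then
    the integral of the measures of the sections, almost all of which are null. *)
Lemma indep_fubini_null (Z : set (OmegaJ * R)) : measurable Z ->
  {ae distribution P idJ, forall w, P.-negligible (X t @^-1` [set y | Z (w, y)])} ->
  P [set w | Z (w, X t w)] = 0%E.
Proof.
move=> mZ Z0.
have -> : P [set w | Z (w, X t w)] = distribution P pairJ Z by [].
rewrite -(product_measure_unique (m1 := distribution P idJ)
  (m2 := distribution P (X t)) _ mZ); last first.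
  by move=> A B mA mB; exact (indep_sigma tJ mA mB).
rewrite /product_measure1 -[RHS](integral0 (distribution P idJ) setT).
apply: ge0_ae_eq_integral => //.
  exact: measurable_fun_xsection.
apply: filterS Z0 => w Zw _ /=.
rewrite -[LHS]/(P (X t @^-1` xsection Z w)).
apply: measure_negligible.
  by apply: measurable_preim; exact: measurable_xsection.
by apply: negligibleS Zw => w' /=; rewrite /xsection /= inE.
Qed.

Variables (f : (I -> R) -> R) (g : I -> R).
Hypothesis pf : polyfun f.

(* The coordinates in [J] are random, the others are frozen at [g]. *)
Let mix (J' : {set I}) w s := if s \in J' then X s w else g s.

(* For almost every value of the coordinates in [J], the univariate polynomial *)
(* in the coordinate [t] does not vanish at [g t], hence has few roots.        *)
Lemma polyfun_mixU1 :
  P [set w | f (mix J w) = 0] = 0%E -> P [set w | f (mix (t |: J) w) = 0] = 0%E.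
Proof.
move=> fJ0.
pose Z : set (OmegaJ * R) :=
  [set wy | f (fun s => if s == t then wy.2 else mix J wy.1 s) = 0].
have -> : [set w | f (mix (t |: J) w) = 0] = [set w | Z (w, X t w)].
  congr mkset; apply/funext => w; rewrite /Z /=; congr (f _ = 0).
  by apply/funext => s; rewrite /mix in_setU1; case: eqP => // ->.
have mmix s : measurable_fun setT (fun w : OmegaJ => mix J w s).
  rewrite /mix; case: (s \in J) (@measurable_coordJ s) => [mXs|_].
    exact: mXs.
  exact: measurable_cst.
apply: indep_fubini_null.
  have mF := measurable_polyfun (T := (OmegaJ * R)%type)
    (phi := fun s wy => if s == t then wy.2 else mix J wy.1 s) pf.
  rewrite /Z -[X in measurable X]setTI.
  apply: (mF _ measurableT [set 0]); last exact: measurable_set1.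
  move=> s; case: (s == t); first exact: measurable_snd.
  exact: (measurableT_comp (mmix s)) measurable_fst.
exists [set w | f (mix J w) = 0]; split => //.
  rewrite -[X in measurable X]setTI.
  exact: (measurable_polyfun (T := OmegaJ) (phi := fun s w => mix J w s)
    pf mmix measurableT (measurable_set1 0)).
move=> w /=; apply: contra_notP => /eqP fw; rewrite /Z /=.
have [q qE] := polyfun_line (mix J w) t pf.
under eq_fun do rewrite qE; apply: poly_root_negligible.
apply: contraNneq fw => q0; have := qE (g t); rewrite q0 horner0 => <-.
apply/eqP; congr f; apply/funext => s; case: eqP => // ->.
by rewrite /mix (negPf tJ).
Qed.

End Fubini.

(** Coordinates become random one by one along a list: the empty list is the deterministic point
    [g], [polyfun_mixU1] adds one coordinate, and [enum I] makes all of them random. *)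
Lemma polyfun_neq0_ae (f : (I -> R) -> R) (g : I -> R) :
  polyfun f -> f g != 0 -> {ae P, forall w, f (fun t => X t w) != 0}.
Proof.
move=> pf fg.
have mix0 (s : seq I) :
    P [set w | f (fun t => if t \in [set t in s] then X t w else g t) = 0] = 0%E.
  elim: s => [|t s IHs].
    rewrite (_ : [set w | _] = set0) ?measure0 // -subset0 => w /= fw.
    move: fg; rewrite -fw; apply/negP; rewrite negbK; apply/eqP; congr f.
    by apply/funext => t; rewrite inE.
  have [ts|ts] := boolP (t \in s).
    rewrite (_ : [set x in t :: s] = [set x in s]) //.
    by apply/setP => x; rewrite !inE; case: eqP => // ->; rewrite ts.
  have -> : [set x in t :: s] = t |: [set x in s] by apply/setP => x; rewrite !inE.
  by apply: polyfun_mixU1 => //; rewrite inE.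
exists [set w | f (fun t => X t w) = 0]; split.
- rewrite -[X in measurable X]setTI.
  have mX t : measurable_fun setT (X t) by exact: measurable_funPT.
  exact: (measurable_polyfun (phi := fun s w => X s w) pf mX measurableT (measurable_set1 0)).
- rewrite -(mix0 (enum I)); congr (P (mkset _)); apply/funext => w; congr (f _ = 0).
  by apply/funext => t; rewrite inE mem_enum.
- by move=> w /= /negP; rewrite negbK => /eqP.
Qed.

End Independence.

Local Open Scope complex_scope.
Local Open Scope sesquilinear_scope.

(** * Orthonormal bases and Gram matrices *)

Section Adjoint.
Variable C : numClosedFieldType.

Lemma adjmxM m n p (A : 'M[C]_(m, n)) (B : 'M[C]_(n, p)) :
  (A *m B)^t* = B^t* *m A^t*.
Proof. by rewrite trmx_mul map_mxM. Qed.

Lemma adjmxZ m n (a : C) (A : 'M[C]_(m, n)) : (a *: A)^t* = Num.conj a *: A^t*.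
Proof. by apply/matrixP => i j; rewrite !mxE rmorphM. Qed.

Lemma mulmx_adj_eq0 m n (A : 'M[C]_(m, n)) : A *m A^t* = 0 -> A = 0.
Proof.
move=> A0; apply/matrixP => i j; rewrite mxE.
have := congr1 (fun M : 'M[C]_m => M i i) A0; rewrite !mxE => /eqP.
rewrite psumr_eq0 => [/allP /(_ j)|k _]; last by rewrite !mxE mul_conjC_ge0.
by rewrite mem_index_enum !mxE mul_conjC_eq0 => /(_ isT) /eqP.
Qed.

Lemma mulmx_gram_eq0 m n p (A : 'M[C]_(m, n)) (B : 'M[C]_(n, p)) :
  A *m (B *m B^t*) = 0 -> A *m B = 0.
Proof.
move=> AB0; apply: mulmx_adj_eq0.
by rewrite adjmxM mulmxA -[A *m B *m _]mulmxA AB0 mul0mx.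
Qed.

Lemma adjmx_mulmx_eq0 m n (A : 'M[C]_(m, n)) : A^t* *m A = 0 -> A = 0.
Proof.
move=> A0; rewrite -[A]trmxCK (@mulmx_adj_eq0 _ _ (A^t*)) ?trmxCK //.
by rewrite trmx0 map_mx0.
Qed.

Lemma left_inj_unitmx n (M : 'M[C]_n) :
  (forall x : 'rV_n, x *m M = 0 -> x = 0) -> M \in unitmx.
Proof. by move=> inj; rewrite -row_free_unit; apply/inj_row_free. Qed.

Lemma right_inj_unitmx n (M : 'M[C]_n) :
  (forall x : 'cV_n, M *m x = 0 -> x = 0) -> M \in unitmx.
Proof.
move=> inj; rewrite -unitmx_tr; apply: left_inj_unitmx => x xM.
by apply: trmx_inj; rewrite trmx0; apply: inj; rewrite -[M]trmxK -trmx_mul xM trmx0.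
Qed.

Lemma gram_unitmx m n (W : 'M[C]_(m, n)) :
  (forall x : 'cV_n, W *m x = 0 -> x = 0) -> W^t* *m W \in unitmx.
Proof.
move=> inj; apply: right_inj_unitmx => x Wx; apply/inj/adjmx_mulmx_eq0.
by rewrite adjmxM -mulmxA [W^t* *m _]mulmxA Wx mulmx0.
Qed.

Lemma gram_inj m n (W : 'M[C]_(m, n)) p (x : 'M[C]_(n, p)) :
  W^t* *m W \in unitmx -> W *m x = 0 -> x = 0.
Proof. by move=> uW Wx; rewrite -(mulKmx uW x) -mulmxA Wx !mulmx0. Qed.

Lemma orthonormal_row_basis m n r (A : 'M[C]_(m, n)) : \rank A = r ->
  exists2 B : 'M[C]_(r, n), B *m B^t* = 1%:M & (B == A)%MS.
Proof.
move=> <-; exists (schmidt (row_base A)).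
  exact/unitarymxP/schmidt_unitarymx/rank_leq_col.
by rewrite !eqmx_schmidt_free ?row_base_free ?eq_row_base ?submx_refl.
Qed.

End Adjoint.

(** In the spectral basis the product is D^(-1/2) D D^(-1/2). Nonnegative eigenvalues make D^(-1/2)
    real, hence [S] Hermitian; invertibility makes them nonzero. *)
Lemma mxinvsqrt_gram (R : realType) m n (W : 'M[R[i]]_(m, n))
    (S := mxinvsqrt (W^t* *m W)) :
  W^t* *m W \in unitmx -> S^t* *m (W^t* *m W) *m S = 1%:M.
Proof.
move=> uM; pose M := W^t* *m W.
have Mherm : M \is hermsymmx.
  by apply/is_hermitianmxP; rewrite expr0 scale1r /M adjmxM trmxCK.
have /hermitian_normalmx/orthomx_spectralP := Mherm.
rewrite -/M in uM *; rewrite /S -/M {S} /mxinvsqrt.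
set Q := spectralmx M; set D := spectral_diag M => MQD.
have QQ : Q *m Q^t* = 1%:M by apply/unitarymxP/spectral_unitarymx.
have QQ' : Q^t* *m Q = 1%:M := mulmx1C QQ.
rewrite invmx_unitary ?spectral_unitarymx // in MQD.
(* The eigenvalues are diagonal entries of a Gram matrix, hence nonnegative. *)
have dE : diag_mx D = (W *m Q^t*)^t* *m (W *m Q^t*).
  rewrite adjmxM trmxCK -mulmxA [W^t* *m _]mulmxA -/M MQD.
  by rewrite !mulmxA QQ mul1mx -mulmxA QQ mulmx1.
have D_ge0 j : 0 <= D 0 j.
  have -> : D 0 j = diag_mx D j j by rewrite mxE eqxx mulr1n.
  rewrite dE mxE sumr_ge0 // => k _.
  by rewrite !mxE mulrC mul_conjC_ge0.
have uD : diag_mx D \in unitmx.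
  have -> : diag_mx D = Q *m M *m Q^t*.
    by rewrite MQD !mulmxA QQ mul1mx -mulmxA QQ mulmx1.
  rewrite !unitmx_mul uM andbT -/Q spectral_unit /=.
  by rewrite unitarymx_unit // trmxC_unitary spectral_unitarymx.
have D_neq0 j : D 0 j != 0.
  move: uD; rewrite unitmxE det_diag unitfE.
  by move/prodf_neq0 => /(_ j isT).
set E := map_mx _ D.
have Ereal : map_mx Num.conj E = E.
  apply/matrixP => i j; rewrite !mxE ord1.
  by apply/geC0_conj; rewrite invr_ge0 sqrtC_ge0.
have -> : (Q^t* *m diag_mx E *m Q)^t* = Q^t* *m diag_mx E *m Q.
  by rewrite !adjmxM trmxCK tr_diag_mx map_diag_mx Ereal mulmxA.
rewrite MQD.
rewrite -!mulmxA (mulmxA Q) QQ mul1mx (mulmxA Q (Q^t*)) QQ mul1mx.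
rewrite (mulmxA (diag_mx D)) mulmx_diag (mulmxA (diag_mx E)) mulmx_diag.
rewrite [X in diag_mx X](_ : _ = const_mx 1) ?diag_const_mx ?mul1mx //.
apply/matrixP => i j; rewrite !mxE mulrCA.
by rewrite -invfM -expr2 sqrtCK mulfV ?D_neq0.
Qed.

Section Perp.
Variable R : realType.

Lemma same_spanP m n p (X : 'M[R[i]]_(m, n)) (Y : 'M[R[i]]_(m, p)) :
  reflect ((exists B, X = Y *m B) /\ (exists B, Y = X *m B)) (same_span X Y).
Proof.
apply: (iffP andP) => -[].
  by move=> /submxP[B XY] /submxP[B' YX]; split; [exists B^T|exists B'^T];
    apply: trmx_inj; rewrite trmx_mul trmxK.
by move=> [B XY] [B' YX]; split; apply/submxP; [exists B^T|exists B'^T];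
  rewrite -trmx_mul -?XY -?YX.
Qed.

Lemma perp_left m n p (X : 'M[R[i]]_(m, n)) (Y : 'M[R[i]]_(m, p)) :
  is_perp X Y -> Y^t* *m X = 0.
Proof. by case=> _ /andP[/sub_kermxP]. Qed.

Lemma perp_span m n p q (X : 'M[R[i]]_(m, n)) (Y : 'M[R[i]]_(m, p))
    (Z : 'M[R[i]]_(q, m)) : is_perp X Y -> Z *m X = 0 -> exists D, Z = D *m Y^t*.
Proof.
case=> _ /andP[_ kerY] /sub_kermxP ZX.
by apply/submxP; exact: submx_trans ZX kerY.
Qed.

Lemma perp_exists m n p (X : 'M[R[i]]_(m, n)) :
  \rank (kermx X) = p -> exists Y : 'M[R[i]]_(m, p), is_perp X Y.
Proof.
move=> /orthonormal_row_basis[B BB BX].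
by exists (B^t*); split; rewrite trmxCK.
Qed.

(** Adjoint form of [perp_span]: [is_perp] describes left null spaces, while [Vin k] spans a right
    one. *)
Lemma perp_adj m n p q (X : 'M[R[i]]_(m, n)) (Y : 'M[R[i]]_(n, p))
    (Z : 'M[R[i]]_(n, q)) : is_perp (X^t*) Y -> X *m Z = 0 -> exists D, Z = Y *m D.
Proof.
move=> perpY XZ; have [|D ZD] := perp_span (Z := Z^t*) perpY.
  by rewrite -adjmxM XZ trmx0 map_mx0.
by exists (D^t*); rewrite -[Z]trmxCK ZD adjmxM trmxCK.
Qed.

Lemma perp_adj_right m n p (X : 'M[R[i]]_(m, n)) (Y : 'M[R[i]]_(n, p)) :
  is_perp (X^t*) Y -> X *m Y = 0.
Proof.
move=> /perp_left YX; rewrite -[X *m Y]trmxCK adjmxM YX.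
by rewrite trmx0 map_mx0.
Qed.

End Perp.

(** * GIA transceivers over a generic channel *)

Section Kernel.
Variables (R : realType) (K L NB NU : nat).
Hypothesis hL : (1 < L)%N.
Variable H : channels R K L NB NU.

Let i0 : 'I_L := Ordinal (ltnW hL).

Lemma T_mxE n (v : 'M[R[i]]_(_, n)) (i : 'I_L) : T_mx R NU i *m v = submxcol v i.
Proof.
rewrite -[v]submxcolK mul_mxrow_mxcol (bigD1 i) //= eqxx mul1mx mxcolK.
by rewrite big1 ?addr0 // => j /negPf ->; rewrite mul0mx.
Qed.

Lemma A_mx_mul n (v : 'M[R[i]]_(_, n)) k :
  A_mx H k *m v = \mxcol_(r < L.-1)
    (H i0 k (ordS k) *m (T_mx R NU i0 *m v)
     - H (lift i0 r) k (ordS k) *m (T_mx R NU (lift i0 r) *m v)).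
Proof.
rewrite /A_mx mxblockEv -{1}[v]submxcolK mxcol_mul; apply: eq_mxcol => r.
rewrite mul_mxrow_mxcol (bigD1 i0) //= (bigD1 (lift i0 r)) //=.
rewrite !T_mxE /bump leq0n add1n eqxx mulNmx big1 ?addr0 // => j.
by rewrite -!val_eqE /= /bump leq0n add1n => /andP[/negPf -> /negPf ->]; rewrite mul0mx.
Qed.

(** Block row r compares user 0 with user r+1, so the comparison of any two users passes through
    user 0. *)
Lemma A_mx_kerP n (v : 'M[R[i]]_(_, n)) k :
  A_mx H k *m v = 0 <->
  forall i j, H i k (ordS k) *m (T_mx R NU i *m v)
            = H j k (ordS k) *m (T_mx R NU j *m v).
Proof.
rewrite A_mx_mul; split=> [Av0 i j|eqHv].
  have to0 l : H i0 k (ordS k) *m (T_mx R NU i0 *m v)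
              = H l k (ordS k) *m (T_mx R NU l *m v).
    have [r ->|->//] := unliftP i0 l; apply/eqP; rewrite -subr_eq0.
    have := congr1 (fun M => submxcol M r) Av0.
    by rewrite mxcolK submxcol0 => ->.
  by rewrite -!to0.
under eq_mxcol do rewrite (eqHv _ i0) subrr.
exact: mxcol0.
Qed.

Lemma T_mx_inj n (v : 'M[R[i]]_(_, n)) :
  (forall i : 'I_L, T_mx R NU i *m v = 0) -> v = 0.
Proof.
move=> v0; rewrite -[v]submxcolK.
by under eq_mxcol do rewrite -T_mxE v0; exact: mxcol0.
Qed.

(* Given alignment, the last clause says that the signals of the L users of  *)
(* cell k, the interference of the cells other than k - 1 and the aligned    *)
(* interference of cell k - 1 together span the receive space of cell k.     *)
Definition generic_channels : Prop :=
  [/\ forall k, row_free (A_mx H k),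
      forall i k (x : 'cV_NU), H i k (ordS k) *m x = 0 -> x = 0
    & forall k (y : 'rV_NB),
        (forall m l n (v : 'M[R[i]]_(_, n)), A_mx H l *m v = 0 ->
           y *m H m l k *m (T_mx R NU m *m v) = 0) -> y = 0].

End Kernel.

Lemma mxrow_eq0P (V : nmodType) m q (q_ : 'I_q -> nat)
    (B : forall j, 'M[V]_(m, q_ j)) :
  \mxrow_j B j = 0 <-> forall j, B j = 0.
Proof.
split=> [B0 j|B0]; first by rewrite -(mxrowK B j) B0 submxrow0.
by under eq_mxrow do rewrite B0; exact: mxrow0.
Qed.

Lemma det_unitary_conj (C : numClosedFieldType) n (D X : 'M[C]_n) (c : C) :
  D *m D^t* = 1%:M -> \det (1%:M + c *: (D *m X *m D^t*)) = \det (1%:M + c *: X).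
Proof.
move=> DD; rewrite (_ : _ + _ = D *m (1%:M + c *: X) *m D^t*).
  by rewrite !det_mulmx mulrAC -det_mulmx DD det1 mul1r.
by rewrite mulmxDr mulmxDl mulmx1 DD -scalemxAr -scalemxAl.
Qed.

Lemma unitary_rotation (C : numClosedFieldType) m n p q (D : 'M[C]_n) (u : 'M[C]_(m, n))
    (h : 'M[C]_(m, p)) (v v' : 'M[C]_(p, q)) :
  v' *m v'^t* = v *m v^t* ->
  (u *m D^t*)^t* *m h *m v' *m v'^t* *m h^t* *m (u *m D^t*)
  = D *m (u^t* *m h *m v *m v^t* *m h^t* *m u) *m D^t*.
Proof.
move=> vv; rewrite -[_ *m v' *m _]mulmxA vv.
by rewrite adjmxM trmxCK !mulmxA.
Qed.

(** The rate sees the precoder only through V V^H, and rotating the decoder conjugates the matrix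
    under the determinant by [D]. *)
Lemma rate_invariant (R : realType) (K L NB NU ds : nat) (H : channels R K L NB NU)
    (sigma2 : 'I_K -> R) (V V' : precoders R K L NU ds) (U U' : decoders R K L NB ds)
    (D : 'M[R[i]]_ds) i k :
  D *m D^t* = 1%:M -> U' i k = U i k *m D^t* ->
  V' i k *m (V' i k)^t* = V i k *m (V i k)^t* ->
  rate H sigma2 V' U' i k = rate H sigma2 V U i k.
Proof.
move=> DD UD VV; rewrite /rate UD (unitary_rotation _ _ _ VV).
by rewrite (det_unitary_conj _ _ DD).
Qed.

Section ClosedForm.
Variables (R : realType) (K L NB NU ds : nat).
Hypotheses (hK : (1 < K)%N) (hL : (1 < L)%N) (hds : (0 < ds)%N).
Hypothesis hNB : NB = (((K - 1) * L + 1) * ds)%N.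
Hypothesis hNU : NU = (((L - 1) * (K - 1) + 1) * ds)%N.
Variable H : channels R K L NB NU.
Hypothesis genH : generic_channels H.
Variable pw : 'I_L -> 'I_K -> R.
Hypothesis hpw : forall i k, 0 < pw i k.

Lemma rank_ker_A k : \rank (kermx ((A_mx H k)^t*)) = ds.
Proof.
have [freeA _ _] := genH.
rewrite mxrank_ker mxrank_map mxrank_tr (eqP (freeA k)) !sum_nat_const !card_ord.
rewrite hNB hNU; case: L hL => [|[|l]] //= _; case: K hK => [|[|q]] //= _.
by rewrite !subn1 /=; lia.
Qed.

Lemma ordS_neq (k : 'I_K) : ordS k != k.
Proof.
apply/eqP => /(congr1 val) /=; have := ltn_ord k.
rewrite leq_eqVlt => /orP[/eqP kK|kK]; last by rewrite modn_small //;
  move/eqP; rewrite eqn_leq ltnn.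
by rewrite kK modnn => k0; move: hK; rewrite -kK -k0.
Qed.

Lemma ord_pred_neq (k : 'I_K) : k != ord_pred k.
Proof. by rewrite -{1}[k]ord_predK ordS_neq. Qed.

Definition closed_V (Vin : 'I_K -> 'M[R[i]]_(\sum_(c < L) NU, ds)) :
    precoders R K L NU ds := fun i k =>
  (Num.sqrt (pw i k / ds%:R))%:C *:
     (T_mx R NU i *m Vin k *m mxinvsqrt (gram_in (Vin k) i)).

Section Vin.
Variable Vin : 'I_K -> 'M[R[i]]_(\sum_(c < L) NU, ds).
Hypothesis perpVin : forall k, is_perp ((A_mx H k)^t*) (Vin k).
Let W i k := T_mx R NU i *m Vin k.

Lemma W_align i j k : H i k (ordS k) *m W i k = H j k (ordS k) *m W j k.
Proof. exact: (A_mx_kerP hL _ _ _).1 (perp_adj_right (perpVin k)) i j. Qed.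

(** Alignment and injectivity of the cross channels carry the vanishing from user [i] to every user;
    then [Vin k *m x] is zero, and [Vin k] has orthonormal columns. *)
Lemma W_inj i k (x : 'cV_ds) : W i k *m x = 0 -> x = 0.
Proof.
have [_ injH _] := genH; move=> Wx.
have Vx : Vin k *m x = 0.
  apply: T_mx_inj => j; rewrite mulmxA; apply: (injH j k).
  by rewrite mulmxA -(W_align i) -mulmxA Wx mulmx0.
by rewrite -[x]mul1mx -(perpVin k).1 -mulmxA Vx mulmx0.
Qed.

Lemma gram_inE i k : gram_in (Vin k) i = (W i k)^t* *m W i k.
Proof. by rewrite /gram_in adjmxM !mulmxA. Qed.

Lemma gram_in_unitmx i k : gram_in (Vin k) i \in unitmx.
Proof. by rewrite gram_inE; apply: gram_unitmx => x; exact: W_inj. Qed.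

(** The [v j] stack into the kernel of [A_mx H k], which yields one coefficient matrix common to all
    users. *)
Lemma W_span i k n (v : 'I_L -> 'M[R[i]]_(NU, n)) :
  (forall j, H j k (ordS k) *m v j = H i k (ordS k) *m v i) ->
  exists B, forall j, v j = W j k *m B.
Proof.
move=> eqHv; have [|B vB] := perp_adj (Z := \mxcol_j v j) (perpVin k).
  apply/(A_mx_kerP hL) => j l; rewrite !T_mxE !mxcolK.
  by rewrite (eqHv j) (eqHv l).
by exists B => j; rewrite -mulmxA -vB T_mxE mxcolK.
Qed.

Lemma W_generic k n (Y : 'M[R[i]]_(n, NB)) :
  (forall m l, Y *m H m l k *m W m l = 0) -> Y = 0.
Proof.
have [_ _ inj3] := genH; move=> YW; apply/row_matrixP => a; rewrite row0.
apply: (inj3 k) => m l p v /(perp_adj (perpVin l))[B ->].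
by rewrite [T_mx _ _ _ *m _]mulmxA -/(W m l) mulmxA -!row_mul YW mul0mx row0.
Qed.

(* Writing [H i V'_i = H j V'_j B_j], the blocks [V'_j B_j] stack up to a matrix *)
(* with columns in the kernel of [A_mx H k].                                    *)
Lemma aligned_W (V' : precoders R K L NU ds) i k :
  (forall k i j, same_span (H i k (ordS k) *m V' i k) (H j k (ordS k) *m V' j k)) ->
  exists B, V' i k = W i k *m B.
Proof.
move=> align.
have /all_sig[B VB] j : {B | H i k (ordS k) *m V' i k = H j k (ordS k) *m V' j k *m B}.
  by apply/cid; have /same_spanP[] := align k i j.
have [|D VD] := W_span (i := i) (k := k)
    (v := fun j => if j == i then V' i k else V' j k *m B j).
  by move=> j; rewrite eqxx; case: eqP => [->|_] //; rewrite mulmxA -VB.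
by exists D; have := VD i; rewrite eqxx.
Qed.

(** The normalization is an invertible right factor, so spans and null conditions can be read off
    [W]. *)
Lemma closed_VE i k : exists2 Q, Q \in unitmx & closed_V Vin i k = W i k *m Q.
Proof.
exists ((Num.sqrt (pw i k / ds%:R))%:C *: mxinvsqrt (gram_in (Vin k) i)).
  rewrite unitmxZ.
    have := mxinvsqrt_gram (W := W i k); rewrite -gram_inE.
    by move=> /(_ (gram_in_unitmx i k))/mulmx1_unit[].
  rewrite unitfE fmorph_eq0 gt_eqF // sqrtr_gt0 divr_gt0 ?hpw //.
  by rewrite ltr0n.
by rewrite /closed_V -scalemxAr.
Qed.

Lemma closed_V_power i k :
  (closed_V Vin i k)^t* *m closed_V Vin i k = ((pw i k / ds%:R)%:C)%:M.
Proof.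
rewrite /closed_V -/(W i k) adjmxZ -scalemxAl -scalemxAr scalerA adjmxM mulmxA.
rewrite -[_ *m _ *m W i k]mulmxA gram_inE mxinvsqrt_gram -?gram_inE ?gram_in_unitmx //.
rewrite geC0_conj ?ler0c ?sqrtr_ge0 // -rmorphM /= -expr2 sqr_sqrtr ?scalemx1 //.
by rewrite divr_ge0 // ltW ?hpw.
Qed.

End Vin.


Section Precoded.
Variable Vin : 'I_K -> 'M[R[i]]_(\sum_(c < L) NU, ds).
Hypothesis perpVin : forall k, is_perp ((A_mx H k)^t*) (Vin k).
Let V := closed_V Vin.

Lemma closed_V_align k i j :
  same_span (H i k (ordS k) *m V i k) (H j k (ordS k) *m V j k).
Proof.
suff sub i' j' : exists B, H i' k (ordS k) *m V i' k = H j' k (ordS k) *m V j' k *m B.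
  by apply/same_spanP; split; exact: sub.
have [Q uQ VQ] := closed_VE perpVin i' k; have [Q' uQ' VQ'] := closed_VE perpVin j' k.
exists (invmx Q' *m Q); rewrite /V VQ VQ'.
rewrite [_ *m (invmx Q' *m Q)]mulmxA [in RHS](mulmxA (H j' _ _)) mulmxK //.
by rewrite mulmxA (W_align perpVin i' j').
Qed.

Lemma closed_V_generic k n (Y : 'M[R[i]]_(n, NB)) :
  (forall m l, Y *m (H m l k *m V m l) = 0) -> Y = 0.
Proof.
move=> YV; apply: (W_generic perpVin (k := k)) => m l.
have [Q uQ VQ] := closed_VE perpVin m l.
have := YV m l; rewrite /V VQ => /(congr1 (mulmx^~ (invmx Q))).
by rewrite mul0mx !mulmxA mulmxK.
Qed.

(** Both precoders have the same Gram matrix, a nonzero multiple of the identity, which forces Q^H Q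
    = 1. *)
Lemma aligned_V (V' : precoders R K L NU ds) i k :
  (forall k i j, same_span (H i k (ordS k) *m V' i k) (H j k (ordS k) *m V' j k)) ->
  (forall i k, (V' i k)^t* *m V' i k = ((pw i k / ds%:R)%:C)%:M) ->
  exists2 Q, Q *m Q^t* = 1%:M & V' i k = V i k *m Q.
Proof.
move=> align power; have [B VB] := aligned_W perpVin i k align.
have [Q uQ VQ] := closed_VE perpVin i k.
have VD : V' i k = V i k *m (invmx Q *m B).
  by rewrite /V VQ mulmxA mulmxK.
exists (invmx Q *m B) => //; apply: mulmx1C; set D := _ *m B in VD *.
have := power i k; rewrite VD adjmxM mulmxA -[_ *m _ *m V i k]mulmxA.
rewrite closed_V_power //.
rewrite mul_mx_scalar -scalemxAl -[RHS]scalemx1.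
apply: scalerI; rewrite fmorph_eq0 gt_eqF // divr_gt0 ?hpw //.
by rewrite ltr0n.
Qed.

Variable Fbar : 'I_K -> 'M[R[i]]_(NB, ds).
Hypothesis spanF : forall k i, same_span (Fbar k) (H i (ord_pred k) k *m V i (ord_pred k)).

Lemma F_IA_nullP i k n (Y : 'M[R[i]]_(n, NB)) :
  Y *m F_IA H V Fbar i k = 0 <->
  (forall j, j != i -> Y *m (H j k k *m V j k) = 0)
  /\ (forall m l, l != k -> Y *m (H m l k *m V m l) = 0).
Proof.
have nullF m : Y *m Fbar k = 0 <-> Y *m (H m (ord_pred k) k *m V m (ord_pred k)) = 0.
  have /same_spanP[[B FB] [B' FB']] := spanF k m.
  by split=> Y0; [rewrite FB'|rewrite FB]; rewrite mulmxA Y0 mul0mx.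
rewrite /F_IA !mul_mx_row !mul_mxrow; split=> [/eqP|[Yj Yl]].
  rewrite !row_mx_eq0 -andbA => /and3P[/eqP/mxrow_eq0P Yj /eqP/mxrow_eq0P Yl /eqP YF].
  split=> [j|m l lk].
    by rewrite eq_sym => /unlift_some[j' -> _]; exact: Yj.
  have [->|lp] := eqVneq l (ord_pred k); first exact/nullF.
  have l_other : l \in other_cells k by rewrite inE lk lp.
  have := Yl (enum_rank_in l_other l).
  by rewrite enum_rankK_in // /F_cell mul_mxrow => /mxrow_eq0P/(_ m).
apply/eqP; rewrite !row_mx_eq0 -andbA; apply/and3P; split; apply/eqP.
- by apply/mxrow_eq0P => j; apply: Yj; rewrite eq_sym neq_lift.
- apply/mxrow_eq0P => t; rewrite /F_cell mul_mxrow; apply/mxrow_eq0P => m.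
  by apply: Yl; have := enum_valP t; rewrite inE => /andP[].
- apply/(nullF (Ordinal (ltnW hL))); apply: Yl.
  by rewrite eq_sym ord_pred_neq.
Qed.

Lemma F_IA_null_inj i k n (Y : 'M[R[i]]_(n, NB)) :
  Y *m F_IA H V Fbar i k = 0 -> Y *m (H i k k *m V i k) = 0 -> Y = 0.
Proof.
move=> /F_IA_nullP[Yj Yl] Yi; apply: (closed_V_generic (k := k)) => m l.
have [->|lk] := eqVneq l k; last exact: Yl.
by have [->|mi] := eqVneq m i; last exact: Yj.
Qed.

(** The null space has dimension at most d_s because multiplication by the desired signal, which has
    d_s columns, is injective on it; at least d_s because [F_IA] has N_B - d_s columns. *)
Lemma closed_U_exists i k :
  exists U : 'M[R[i]]_(NB, ds), is_perp (F_IA H V Fbar i k) U.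
Proof.
apply: perp_exists; apply/eqP; rewrite eqn_leq; apply/andP; split.
  set N := kermx _.
  suff <- : \rank (N *m (H i k k *m V i k)) = \rank N by exact: rank_leq_col.
  apply/mxrank_injP/eqP; apply: (@F_IA_null_inj i k).
    by apply/sub_kermxP; exact: capmxSl.
  by apply/sub_kermxP; exact: capmxSr.
rewrite mxrank_ker leq_subRL; last exact: rank_leq_row.
apply: (leq_trans (n := (\sum_(j < L.-1) ds
       + \sum_(t < #|other_cells k|) \sum_(m < L) ds + ds) + ds)).
  by rewrite leq_add2r rank_leq_col.
have cardO : (#|other_cells k|.+2 = K)%N.
  rewrite -[RHS]card_ord [RHS](cardD1 k) [X in _ = (_ + X)%N](cardD1 (ord_pred k)) !inE.
  rewrite eq_sym ord_pred_neq !add1n; congr _.+2.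
  by apply: eq_card => l; rewrite !inE andbC andbT.
have -> : NB = ((#|other_cells k|.+1 * L + 1) * ds)%N.
  by rewrite hNB; congr ((_ * _ + 1) * _)%N; lia.
rewrite !sum_nat_const !card_ord; move: #|_| => c.
by case: L hL => [|l] //= _; lia.
Qed.

End Precoded.

Lemma closed_form_exists : exists Vin Fbar V U,
  @is_closed_form R K L NB NU ds H pw Vin Fbar V U.
Proof.
have /choice[Vin perpVin] : forall k, exists Y : 'M[R[i]]_(_, ds), is_perp ((A_mx H k)^t*) Y.
  by move=> k; exact/perp_exists/rank_ker_A.
pose V := closed_V Vin; pose i0 : 'I_L := Ordinal (ltnW hL).
pose Fbar k := H i0 (ord_pred k) k *m V i0 (ord_pred k).
have spanF k i : same_span (Fbar k) (H i (ord_pred k) k *m V i (ord_pred k)).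
  rewrite /Fbar; have := closed_V_align perpVin (ord_pred k) i0 i.
  by rewrite ord_predK.
have /choice[U perpU] : forall ik : 'I_L * 'I_K,
    exists U : 'M[R[i]]_(NB, ds), is_perp (F_IA H V Fbar ik.1 ik.2) U.
  by move=> ik; exact: closed_U_exists.
exists Vin, Fbar, V, (fun i k => U (i, k)); split=> // [k|i k].
(* [Fbar k] has full column rank: the cross channel is injective, and so is the precoder, whose Gram
   matrix is a positive multiple of the identity. *)
- split=> //; apply/eqP.
  rewrite -mxrank_tr -/(row_free _); apply/inj_row_free => x.
  move=> /(congr1 trmx); rewrite trmx_mul trmxK trmx0 => Fx.
  have [_ injH _] := genH.
  apply: trmx_inj; rewrite trmx0.
  have Vx : V i0 (ord_pred k) *m x^T = 0.
    by apply: (injH i0 (ord_pred k)); rewrite mulmxA ord_predK.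
  have := closed_V_power perpVin i0 (ord_pred k).
  rewrite -/V => /(congr1 (mulmx^~ x^T)); rewrite -mulmxA Vx mulmx0 mul_scalar_mx => /esym/eqP.
  rewrite scaler_eq0 fmorph_eq0 gt_eqF ?divr_gt0 ?hpw ?ltr0n //=.
  by move/eqP.
- exact: (perpU (i, k)).
Qed.

Variable sigma2 : 'I_K -> R.

Lemma closed_form_optimal Vin Fbar V U :
  @is_closed_form R K L NB NU ds H pw Vin Fbar V U ->
  [/\ forall i k, gram_in (Vin k) i \in unitmx,
      is_GIA_transceiver H pw V U
    & forall (V' : precoders R K L NU ds) (U' : decoders R K L NB ds),
        is_GIA_transceiver H pw V' U' ->
        forall i k, rate H sigma2 V' U' i k = rate H sigma2 V U i k].
Proof.
move=> [perpVin VE rF perpU].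
have {VE} VE : V = closed_V Vin by apply/funext => i; apply/funext => k; rewrite VE.
subst V; set V := closed_V Vin.
have spanF k i : same_span (Fbar k) (H i (ord_pred k) k *m V i (ord_pred k)) by have [] := rF k.
have nullU i k : (forall j, j != i -> (U i k)^t* *m (H j k k *m V j k) = 0)
    /\ (forall m l, l != k -> (U i k)^t* *m (H m l k *m V m l) = 0).
  exact/(F_IA_nullP spanF)/perp_left.
split; [exact: gram_in_unitmx|split|].
- exact: closed_V_align.
- exact: closed_V_power.
- by move=> i k; have [] := perpU i k.
- split=> [i j k ji|i k m l lk]; rewrite -mulmxA; first by apply: (nullU i k).1.
  by apply: (nullU i k).2.
(* If [x] kills the effective channel, then x U^H annihilates the signals of all users, so it
   vanishes by genericity; U^H U = 1 then gives x = 0. *)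
- move=> i k; apply/eqP; rewrite -/(row_free _); apply/inj_row_free => x xUHV.
  have : x *m (U i k)^t* = 0.
    apply: (closed_V_generic perpVin (k := k)) => m l.
    have [->|lk] := eqVneq l k; last by rewrite -mulmxA (nullU i k).2 // mulmx0.
    have [->|mi] := eqVneq m i; last by rewrite -mulmxA (nullU i k).1 // mulmx0.
    by rewrite -mulmxA [(U i k)^t* *m _]mulmxA.
  move=> /(congr1 (mulmx^~ (U i k))); rewrite -mulmxA (perpU i k).1.
  by rewrite mulmx1 mul0mx.
move=> V' U' [align power normU [null1 null2] _] i k.
have VQ j l : exists2 Q, Q *m Q^t* = 1%:M & V' j l = V j l *m Q by exact: aligned_V.
(* The unitary factor of [V'] cancels, so the competitor nulls the interference of the closed-form
   precoders too. *)
have nullV j l m (Y : 'M[R[i]]_(ds, m)) (hjl : 'M[R[i]]_(m, NU)) :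
    Y *m hjl *m V' j l = 0 -> Y *m (hjl *m V j l) = 0.
  have [Q QQ ->] := VQ j l => /(congr1 (mulmx^~ (Q^t*))).
  by rewrite mul0mx -!mulmxA QQ mulmx1.
have [D UD] : exists D, (U' i k)^t* = D *m (U i k)^t*.
  apply: (perp_span (perpU i k)); apply/(F_IA_nullP spanF); split=> [j ji|m l lk].
    by apply: nullV; exact: null1.
  by apply: nullV; exact: null2.
have DD : D *m D^t* = 1%:M.
  have := normU i k; rewrite -{2}[U' i k]trmxCK UD adjmxM trmxCK.
  by rewrite mulmxA -[_ *m _ *m U i k]mulmxA (perpU i k).1 mulmx1.
have U'E : U' i k = U i k *m D^t* by rewrite -[U' i k]trmxCK UD adjmxM trmxCK.
have VV : V' i k *m (V' i k)^t* = V i k *m (V i k)^t*.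
  have [Q QQ ->] := VQ i k.
  by rewrite adjmxM mulmxA -[_ *m Q *m _]mulmxA QQ mulmx1.
exact: rate_invariant DD U'E VV.
Qed.

End ClosedForm.

Lemma ord_bij (T : finType) n : #|T| = n ->
  exists (f : 'I_n -> T) (g : T -> 'I_n), cancel f g /\ cancel g f.
Proof.
move=> <-; exists enum_val, enum_rank.
by split; [exact: enum_valK|exact: enum_rankK].
Qed.

Lemma sum_delta (S : nzRingType) (I : finType) (T : eqType) (f : I -> T) (g : T -> I)
    (F : I -> S) u : cancel f g -> cancel g f ->
  \sum_i F i * (f i == u)%:R = F (g u).
Proof.
move=> fK gK; rewrite (bigD1 (g u)) //= gK eqxx mulr1 big1 ?addr0 // => i iu.
case: eqP => [fu|_]; last by rewrite mulr0.
by rewrite -fu fK eqxx in iu.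
Qed.

(** * A channel at which the Gram determinants do not vanish *)

(* The N_B receive coordinates are indexed by d_s core coordinates (None, s) *)
(* and, for each user m, (K-1) d_s coordinates (Some (m, q), s). The channel  *)
(* [incl m] misses exactly the coordinates of user m, so that the ranges of   *)
(* the [incl m] intersect in the core. The channels [core_to m q] of the      *)
(* users of cells other than k - 1 to cell k move the core onto the disjoint  *)
(* blocks (Some (m, q), _).                                                   *)
Section Configuration.
Variables (R : realType) (K L NB NU ds : nat).
Hypothesis hL : (1 < L)%N.
Variable k : 'I_K.

Let IB : finType := (option ('I_L * 'I_K.-1) * 'I_ds)%type.
Let IU : finType := (option ('I_L.-1 * 'I_K.-1) * 'I_ds)%type.
Variables (f : 'I_NB -> IB) (f' : IB -> 'I_NB).
Hypotheses (fK : cancel f f') (f'K : cancel f' f).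
Variables (h : 'I_NU -> IU) (h' : IU -> 'I_NU).
Hypotheses (hK : cancel h h') (h'K : cancel h' h).

Let i0 : 'I_L := Ordinal (ltnW hL).

Let emb (m : 'I_L) (u : IU) : IB :=
  (if u.1 is Some (j, q) then Some (lift m j, q) else None, u.2).

Let emb_inj m : injective (emb m).
Proof.
move=> [[[j q]|] s] [[[j' q']|] s'] //=; rewrite /emb /=.
  case=> E -> ->; suff -> : j = j' by [].
  by apply: (@lift_inj _ m); exact: val_inj.
by case=> ->.
Qed.

Definition incl (m : 'I_L) : 'M[R[i]]_(NB, NU) :=
  \matrix_(a, b) (f a == emb m (h b))%:R.

Definition core_to (m : 'I_L) (q : 'I_K.-1) : 'M[R[i]]_(NB, NU) :=
  \matrix_(a, b) ((f a == (Some (m, q), (h b).2)) && ((h b).1 == None))%:R.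

(** The witness depends on the receiving cell [k]: the third genericity clause is checked at [k]
    only, and each determinant may use its own witness. *)
Definition config : channels R K L NB NU := fun m l l' =>
  if l' == ordS l then incl m
  else if unlift (ord_pred k) l is Some q then core_to m q else 0.

Lemma mul_row_incl (y : 'rV[R[i]]_NB) m b : (y *m incl m) 0 b = y 0 (f' (emb m (h b))).
Proof.
rewrite mxE -[RHS](sum_delta _ _ fK f'K).
by apply: eq_bigr => a _; rewrite mxE.
Qed.

Lemma incl_col (x : 'cV[R[i]]_NU) m b : (incl m *m x) (f' (emb m (h b))) 0 = x b 0.
Proof.
rewrite mxE -[in RHS](hK b) -[RHS](sum_delta (fun b => x b 0) _ hK h'K).
apply: eq_bigr => b' _; rewrite mxE f'K (inj_eq (@emb_inj m)) mulrC.
by rewrite [h b == _]eq_sym.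
Qed.

Lemma row_incl_eq0 (y : 'rV[R[i]]_NB) m x :
  y *m incl m = 0 -> (if x.1 is Some (j, q) then j != m else true) -> y 0 (f' x) = 0.
Proof.
move=> y0 xm; suff [u ->] : exists u, x = emb m u.
  by have := congr1 (fun M : 'rV[R[i]]_NU => M 0 (h' u)) y0; rewrite mul_row_incl h'K mxE.
case: x xm => [[[j q]|] s] /= => [jm|_]; last by exists (None, s).
have [j' jE _] : {j' | j = lift m j' & unlift m j = Some j'}.
  by apply: unlift_some; rewrite eq_sym.
by exists (Some (j', q), s); rewrite /emb /= -jE.
Qed.

(** Every [incl m] sends this vector to the same core coordinate, so L stacked copies lie in the
    kernel of each [A_mx config l]. *)
Definition core_col (s : 'I_ds) : 'cV[R[i]]_NU := \col_b (h b == (None, s))%:R.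

Lemma incl_core m s : incl m *m core_col s = \col_a (f a == (None, s))%:R.
Proof.
apply/colP => a; rewrite !mxE.
transitivity (\sum_b (f a == emb m (h b))%:R * (h b == (None, s))%:R : R[i]).
  by apply: eq_bigr => b _; rewrite !mxE.
by rewrite (sum_delta _ _ hK h'K) h'K.
Qed.

Lemma core_to_core m q s :
  core_to m q *m core_col s = \col_a (f a == (Some (m, q), s))%:R.
Proof.
apply/colP => a; rewrite !mxE.
transitivity (\sum_b ((f a == (Some (m, q), (h b).2)) && ((h b).1 == None))%:R
    * (h b == (None, s))%:R : R[i]).
  by apply: eq_bigr => b _; rewrite !mxE.
by rewrite (sum_delta _ _ hK h'K) h'K /= eqxx andbT.
Qed.

Lemma mul_row_delta (y : 'rV[R[i]]_NB) x :
  y *m (\col_a (f a == x)%:R) = (y 0 (f' x))%:M.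
Proof.
apply/rowP => j; rewrite ord1 !mxE mulr1n -[RHS](sum_delta _ _ fK f'K).
by apply: eq_bigr => a _; rewrite mxE.
Qed.

(** Column block r+1 confines the r-th piece of [y] to the coordinates of user r+1. There no other
    piece contributes to the sum, which column block 0 forces to vanish outside the coordinates of
    user 0. *)
Lemma config_generic_A l : row_free (A_mx config l).
Proof.
apply/inj_row_free => y yA.
have {}yA (c : 'I_L) : \sum_(r < L.-1) submxrow y r *m
    (if c == 0%N :> nat then incl c else if c == r.+1 :> nat then - incl c else 0) = 0.
  move: yA; rewrite /A_mx -{1}[y]submxrowK mul_mxrow_mxblock.
  move=> /(congr1 (fun M => submxrow M c)); rewrite mxrowK submxrow0 /config eqxx.
  by [].
have y_succ r : submxrow y r *m incl (lift i0 r) = 0.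
  have := yA (lift i0 r); rewrite (bigD1 r) //= /bump leq0n add1n eqxx.
  rewrite big1 ?addr0 => [|r' r'r]; last by rewrite eqSS val_eqE eq_sym (negPf r'r) mulmx0.
  by rewrite mulmxN => /eqP; rewrite oppr_eq0 => /eqP.
have y_sum : (\sum_r submxrow y r) *m incl i0 = 0.
  by rewrite mulmx_suml; exact: yA i0.
rewrite -[y]submxrowK.
suff y0 r : submxrow y r = 0 by under eq_mxrow do rewrite y0; exact: mxrow0.
apply/rowP => a; rewrite -(fK a) [RHS]mxE; set x := f a.
have [xr|] := boolP (if x.1 is Some (j, q) then j != lift i0 r else true).
  exact: row_incl_eq0 (y_succ r) xr.
case xE : x.1 => [[j q]|//]; rewrite negbK => /eqP jE.
have := row_incl_eq0 (x := x) y_sum; rewrite xE jE eq_sym neq_lift => /(_ isT).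
rewrite summxE (bigD1 r) //= big1 ?addr0 // => r' r'r.
apply: row_incl_eq0 (y_succ r') _; rewrite xE jE.
by rewrite (inj_eq lift_inj) eq_sym.
Qed.

Lemma config_generic_H m l (x : 'cV[R[i]]_NU) : config m l (ordS l) *m x = 0 -> x = 0.
Proof.
rewrite /config eqxx => Hx; apply/colP => b.
by rewrite -(incl_col x m) Hx !mxE.
Qed.

Lemma config_generic_rank (y : 'rV[R[i]]_NB) :
  (forall m l n (v : 'M[R[i]]_(_, n)), A_mx config l *m v = 0 ->
     y *m config m l k *m (T_mx R NU m *m v) = 0) -> y = 0.
Proof.
move=> yH.
have {}yH m l s : y *m (config m l k *m core_col s) = 0.
  have := yH m l _ (\mxcol_(c < L) core_col s); rewrite T_mxE mxcolK -mulmxA; apply.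
  apply/(A_mx_kerP hL) => i j.
  by rewrite !T_mxE !mxcolK /config eqxx !incl_core.
apply/rowP => a; rewrite -(fK a) [RHS]mxE; case: (f a) => [[[m q]|] s].
  have := yH m (lift (ord_pred k) q) s; rewrite /config.
  (* The successor map is injective, so [k] is not the successor of this cell and its channel to [k]
     is [core_to m q]. *)
  rewrite -{1}[k]ord_predK (inj_eq (can_inj (@ordSK K))) eq_liftF liftK.
  rewrite core_to_core mul_row_delta => /(congr1 (fun M : 'M[R[i]]_1 => M 0 0)).
  by rewrite !mxE.
have := yH i0 (ord_pred k) s; rewrite /config ord_predK eqxx.
rewrite incl_core mul_row_delta => /(congr1 (fun M : 'M[R[i]]_1 => M 0 0)).
by rewrite !mxE.
Qed.

End Configuration.

(** * Almost sure genericity *)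

Section ComplexPolyfun.
Variables (I : Type) (R : realType).
Implicit Types f h : (I -> R) -> R[i].

(** The independent variables are real, and splitting into real and imaginary parts makes
    conjugation, present in Gram matrices, a polynomial operation. *)
Definition cpolyfun f :=
  polyfun (fun g => complex.Re (f g)) /\ polyfun (fun g => complex.Im (f g)).

Lemma polyfun_eq (f h : (I -> R) -> R) : f =1 h -> polyfun f -> polyfun h.
Proof. by move=> /funext->. Qed.

Lemma cpolyfun_eq f h : f =1 h -> cpolyfun f -> cpolyfun h.
Proof. by move=> /funext->. Qed.

Lemma cpolyfun_cst c : cpolyfun (fun=> c).
Proof. by split; exact: polyfun_cst. Qed.

Lemma cpolyfunD f h : cpolyfun f -> cpolyfun h -> cpolyfun (fun g => f g + h g).
Proof.
move=> [f1 f2] [h1 h2]; split.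
  by apply: polyfun_eq (polyfunD f1 h1) => g; case: (f g) (h g) => [? ?] [].
by apply: polyfun_eq (polyfunD f2 h2) => g; case: (f g) (h g) => [? ?] [].
Qed.

Lemma polyfunN (f : (I -> R) -> R) : polyfun f -> polyfun (fun g => - f g).
Proof.
move=> pf; apply: polyfun_eq (polyfunM (polyfun_cst _ (-1)) pf) => g.
by rewrite mulN1r.
Qed.

Lemma cpolyfunM f h : cpolyfun f -> cpolyfun h -> cpolyfun (fun g => f g * h g).
Proof.
move=> [f1 f2] [h1 h2]; split.
  apply: polyfun_eq (polyfunD (polyfunM f1 h1) (polyfunN (polyfunM f2 h2))) => g.
  by case: (f g) (h g) => [? ?] [].
apply: polyfun_eq (polyfunD (polyfunM f1 h2) (polyfunM f2 h1)) => g.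
by case: (f g) (h g) => [? ?] [].
Qed.

Lemma cpolyfun_conj f : cpolyfun f -> cpolyfun (fun g => Num.conj (f g)).
Proof.
move=> [f1 f2]; split; first by apply: polyfun_eq f1 => g; case: (f g).
by apply: polyfun_eq (polyfunN f2) => g; case: (f g).
Qed.

Lemma cpolyfun_sum (J : Type) (r : seq J) (p : pred J) (F : J -> (I -> R) -> R[i]) :
  (forall j, cpolyfun (F j)) -> cpolyfun (fun g => \sum_(j <- r | p j) F j g).
Proof.
move=> pF; elim: r => [|j r IHr].
  by apply: cpolyfun_eq (cpolyfun_cst 0) => g; rewrite big_nil.
have := cpolyfunD (pF j) IHr; case pj: (p j) => pFr.
  by apply: cpolyfun_eq pFr => g; rewrite big_cons pj.
by apply: cpolyfun_eq IHr => g; rewrite big_cons pj.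
Qed.

Lemma cpolyfun_prod (J : Type) (r : seq J) (p : pred J) (F : J -> (I -> R) -> R[i]) :
  (forall j, cpolyfun (F j)) -> cpolyfun (fun g => \prod_(j <- r | p j) F j g).
Proof.
move=> pF; elim: r => [|j r IHr].
  by apply: cpolyfun_eq (cpolyfun_cst 1) => g; rewrite big_nil.
have := cpolyfunM (pF j) IHr; case pj: (p j) => pFr.
  by apply: cpolyfun_eq pFr => g; rewrite big_cons pj.
by apply: cpolyfun_eq IHr => g; rewrite big_cons pj.
Qed.

Definition mxpolyfun m n (M : (I -> R) -> 'M[R[i]]_(m, n)) :=
  forall a b, cpolyfun (fun g => M g a b).

Lemma mxpolyfun_cst m n (A : 'M[R[i]]_(m, n)) : mxpolyfun (fun=> A).
Proof. by move=> a b; exact: cpolyfun_cst. Qed.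

Lemma mxpolyfunD m n (M N : (I -> R) -> 'M[R[i]]_(m, n)) :
  mxpolyfun M -> mxpolyfun N -> mxpolyfun (fun g => M g + N g).
Proof.
move=> pM pN a b; apply: cpolyfun_eq (cpolyfunD (pM a b) (pN a b)) => g.
by rewrite mxE.
Qed.

Lemma mxpolyfunM m n p (M : (I -> R) -> 'M[R[i]]_(m, n)) (N : (I -> R) -> 'M[R[i]]_(n, p)) :
  mxpolyfun M -> mxpolyfun N -> mxpolyfun (fun g => M g *m N g).
Proof.
move=> pM pN a b; have := fun c => cpolyfunM (pM a c) (pN c b).
move=> /(cpolyfun_sum (index_enum _) xpredT); apply: cpolyfun_eq => g.
by rewrite mxE.
Qed.

Lemma mxpolyfunZ m n c (M : (I -> R) -> 'M[R[i]]_(m, n)) :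
  cpolyfun c -> mxpolyfun M -> mxpolyfun (fun g => c g *: M g).
Proof.
by move=> pc pM a b; apply: cpolyfun_eq (cpolyfunM pc (pM a b)) => g; rewrite mxE.
Qed.

Lemma mxpolyfunN m n (M : (I -> R) -> 'M[R[i]]_(m, n)) :
  mxpolyfun M -> mxpolyfun (fun g => - M g).
Proof.
move=> pM a b; apply: cpolyfun_eq (mxpolyfunZ (cpolyfun_cst (-1)) pM a b) => g.
by rewrite scaleN1r.
Qed.

Lemma mxpolyfun_adj m n (M : (I -> R) -> 'M[R[i]]_(m, n)) :
  mxpolyfun M -> mxpolyfun (fun g => (M g)^t*).
Proof.
by move=> pM a b; apply: cpolyfun_eq (cpolyfun_conj (pM b a)) => g; rewrite !mxE.
Qed.

Lemma mxpolyfun_sum (J : Type) (r : seq J) m n (F : J -> (I -> R) -> 'M[R[i]]_(m, n)) :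
  (forall j, mxpolyfun (F j)) -> mxpolyfun (fun g => \sum_(j <- r) F j g).
Proof.
move=> pF a b; apply: cpolyfun_eq (cpolyfun_sum r xpredT (fun j => pF j a b)) => g.
by rewrite summxE.
Qed.

Lemma cpolyfun_det n (M : (I -> R) -> 'M[R[i]]_n) :
  mxpolyfun M -> cpolyfun (fun g => \det (M g)).
Proof.
move=> pM; apply: cpolyfun_sum => s; apply: cpolyfunM; first exact: cpolyfun_cst.
by apply: cpolyfun_prod => j; exact: pM.
Qed.

Lemma mxpolyfun_adjugate n (M : (I -> R) -> 'M[R[i]]_n) :
  mxpolyfun M -> mxpolyfun (fun g => \adj (M g)).
Proof.
move=> pM a b; have pdet : cpolyfun (fun g => \det (row' b (col' a (M g)))).
  apply: cpolyfun_det => c d; apply: cpolyfun_eq (pM (lift b c) (lift a d)) => g.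
  by rewrite !mxE.
apply: cpolyfun_eq (cpolyfunM (cpolyfun_cst _) pdet) => g.
by rewrite mxE.
Qed.

End ComplexPolyfun.

(** Reduces to the real case through the squared modulus. *)
Lemma cpolyfun_neq0_ae d (Omega : measurableType d) (R : realType)
    (P : probability Omega R) (I : finType) (X : I -> {RV P >-> R})
    (f : (I -> R) -> R[i]) (g : I -> R) :
  mutually_independent X -> (forall t y, P (X t @^-1` [set y])%classic = 0%E) ->
  cpolyfun f -> f g != 0 -> {ae P, forall w, f (fun t => X t w) != 0}.
Proof.
move=> indX atomX [pf1 pf2] fg.
have sqE (z : R[i]) : complex.Re z * complex.Re z + complex.Im z * complex.Im z = 0 <-> z = 0.
  split=> [/eqP|->]; last by rewrite /= mulr0 addr0.
  rewrite paddr_eq0 ?mulf_eq0 ?orbb -?expr2 ?sqr_ge0 //.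
  by case: z => x y /= /andP[/eqP-> /eqP->].
have pf := polyfunD (polyfunM pf1 pf1) (polyfunM pf2 pf2).
have fg' : complex.Re (f g) * complex.Re (f g) + complex.Im (f g) * complex.Im (f g) != 0.
  by apply: contraNneq fg => /sqE ->.
apply: filterS (polyfun_neq0_ae indX atomX pf fg') => w.
by apply: contraNneq => f0; apply/eqP/sqE.
Qed.

(** The number y S y^H is the sum of the squared norms of the [y *m B j]. *)
Lemma sum_gram_eq0 (C : numClosedFieldType) (J : finType) m n (B : J -> 'M[C]_(m, n))
    (y : 'rV[C]_m) : y *m (\sum_j B j *m (B j)^t*) = 0 -> forall j, y *m B j = 0.
Proof.
move=> yS j; apply: mulmx_adj_eq0; apply/rowP => a; rewrite ord1 [RHS]mxE.
have : (y *m (\sum_j B j *m (B j)^t*) *m y^t*) 0 0 = 0 by rewrite yS mul0mx mxE.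
rewrite mulmx_sumr mulmx_suml summxE => /eqP.
have E i : y *m (B i *m (B i)^t*) *m y^t* = y *m B i *m (y *m B i)^t*.
  by rewrite adjmxM !mulmxA.
under eq_bigr do rewrite E; rewrite psumr_eq0 => [/allP/(_ j)|i _].
  by rewrite mem_index_enum => /(_ isT) /eqP.
by rewrite mxE sumr_ge0 // => b _; rewrite !mxE mul_conjC_ge0.
Qed.

(** * Genericity as nonvanishing of Gram determinants *)

Section Gram.
Variables (R : realType) (K L NB NU : nat).

Definition gram_A (H : channels R K L NB NU) (l : 'I_K) :=
  A_mx H l *m (A_mx H l)^t*.

Definition gram_H (H : channels R K L NB NU) (i : 'I_L) (k : 'I_K) :=
  (H i k (ordS k))^t* *m H i k (ordS k).

(* A multiple of the orthogonal projection on the kernel of [A_mx H l], with *)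
(* entries polynomial in the channel coefficients and their conjugates.      *)
Definition ker_A (H : channels R K L NB NU) (l : 'I_K) :=
  \det (gram_A H l) *: 1%:M - (A_mx H l)^t* *m \adj (gram_A H l) *m A_mx H l.

Definition received (H : channels R K L NB NU) k (ml : 'I_L * 'I_K) :=
  H ml.1 ml.2 k *m (T_mx R NU ml.1 *m ker_A H ml.2).

Definition gram_received (H : channels R K L NB NU) k :=
  \sum_ml received H k ml *m (received H k ml)^t*.

Lemma A_mx_ker_A H l : A_mx H l *m ker_A H l = 0.
Proof.
rewrite /ker_A mulmxBr -scalemxAr mulmx1 !mulmxA -/(gram_A H l).
by rewrite mul_mx_adj mul_scalar_mx subrr.
Qed.

Lemma ker_A_mul H l n (v : 'M[R[i]]_(_, n)) :
  A_mx H l *m v = 0 -> ker_A H l *m v = \det (gram_A H l) *: v.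
Proof.
by move=> Av; rewrite /ker_A mulmxBl -[_ *m A_mx H l *m v]mulmxA Av mulmx0 subr0 -scalemxAl mul1mx.
Qed.

Lemma generic_of_gram H :
  (forall l, \det (gram_A H l) != 0) -> (forall i k, \det (gram_H H i k) != 0) ->
  (forall k, \det (gram_received H k) != 0) -> generic_channels H.
Proof.
move=> dA dH dR; split=> [l|i k x|k y yH].
- apply/inj_row_free => x xA; have uA : gram_A H l \in unitmx by rewrite unitmxE unitfE; exact: dA.
  by rewrite -(mulmxK uA x) /gram_A [x *m (_ *m _)]mulmxA xA !mul0mx.
- by apply: gram_inj; rewrite unitmxE unitfE; exact: dH.
have uS : gram_received H k \in unitmx by rewrite unitmxE unitfE; exact: dR.
rewrite -(mulmxK uS y) /gram_received mulmx_sumr big1 ?mul0mx // => -[m l] _.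
by rewrite mulmxA /received /= [y *m _]mulmxA yH ?mul0mx // A_mx_ker_A.
Qed.

Lemma gram_A_neq0 H l : row_free (A_mx H l) -> \det (gram_A H l) != 0.
Proof.
move=> freeA; rewrite -unitfE -unitmxE; apply: left_inj_unitmx => x.
move=> xAA; apply/(row_free_inj freeA); rewrite mul0mx.
exact: mulmx_gram_eq0.
Qed.

Lemma gram_H_neq0 H i k :
  (forall x : 'cV_NU, H i k (ordS k) *m x = 0 -> x = 0) -> \det (gram_H H i k) != 0.
Proof. by move=> injH; rewrite -unitfE -unitmxE; exact: gram_unitmx. Qed.

(** [ker_A] scales each kernel vector of [A_mx H l] by a nonzero determinant, so testing on its
    columns tests the whole kernel. *)
Lemma gram_received_neq0 H k :
  (forall l, row_free (A_mx H l)) ->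
  (forall y : 'rV_NB,
     (forall m l n (v : 'M[R[i]]_(_, n)), A_mx H l *m v = 0 ->
        y *m H m l k *m (T_mx R NU m *m v) = 0) -> y = 0) ->
  \det (gram_received H k) != 0.
Proof.
move=> freeA inj; rewrite -unitfE -unitmxE; apply: left_inj_unitmx => y yS.
apply: inj => m l n v Av; have := sum_gram_eq0 yS (m, l).
move=> /(congr1 (mulmx^~ v)); rewrite mul0mx /received /=.
rewrite -!mulmxA ker_A_mul // -!scalemxAr => /eqP.
by rewrite scaler_eq0 (negPf (gram_A_neq0 (freeA l))) mulmxA => /eqP.
Qed.

End Gram.

Section Rayleigh.
Variables (R : realType) (K L NB NU : nat) (eta : 'I_L -> 'I_K -> 'I_K -> R).
Let chan := @rayleigh_channel R K L NB NU eta.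

Lemma mxpolyfun_channel i k l : mxpolyfun (fun g => chan g i k l).
Proof.
apply: mxpolyfunZ; first exact: cpolyfun_cst.
move=> a b; split.
  by apply: polyfun_eq (polyfun_coord _ (i, k, l, a, b, false)) => g; rewrite mxE.
by apply: polyfun_eq (polyfun_coord _ (i, k, l, a, b, true)) => g; rewrite mxE.
Qed.

Lemma mxpolyfun_A l : mxpolyfun (fun g => A_mx (chan g) l).
Proof.
move=> a b; rewrite /A_mx.
have pB (r : 'I_L.-1) (c : 'I_L) : mxpolyfun (fun g =>
    if c == 0%N :> nat then chan g c l (ordS l)
    else if c == r.+1 :> nat then - chan g c l (ordS l)
    else 0 : 'M[R[i]]_(NB, NU)).
  case: (_ == _); first exact: mxpolyfun_channel.
  case: (_ == _); last exact: mxpolyfun_cst.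
  exact/mxpolyfunN/mxpolyfun_channel.
apply: cpolyfun_eq (pB (tagnat.sig1 a) (tagnat.sig1 b)
  (tagnat.sig2 a) (tagnat.sig2 b)) => g.
by rewrite mxE.
Qed.

Lemma mxpolyfun_gram_A l : mxpolyfun (fun g => gram_A (chan g) l).
Proof. by apply: mxpolyfunM; last apply: mxpolyfun_adj; exact: mxpolyfun_A. Qed.

Lemma mxpolyfun_gram_H i k : mxpolyfun (fun g => gram_H (chan g) i k).
Proof. by apply: mxpolyfunM; first apply: mxpolyfun_adj; exact: mxpolyfun_channel. Qed.

Lemma mxpolyfun_received k ml : mxpolyfun (fun g => received (chan g) k ml).
Proof.
apply: mxpolyfunM; first exact: mxpolyfun_channel.
apply: mxpolyfunM; first exact: mxpolyfun_cst.
apply: mxpolyfunD.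
  by apply: mxpolyfunZ; [exact/cpolyfun_det/mxpolyfun_gram_A|exact: mxpolyfun_cst].
apply/mxpolyfunN/mxpolyfunM; last exact: mxpolyfun_A.
apply: mxpolyfunM; first exact/mxpolyfun_adj/mxpolyfun_A.
exact/mxpolyfun_adjugate/mxpolyfun_gram_A.
Qed.

Lemma mxpolyfun_gram_received k : mxpolyfun (fun g => gram_received (chan g) k).
Proof.
apply: mxpolyfun_sum => ml.
by apply: mxpolyfunM; last apply: mxpolyfun_adj; exact: mxpolyfun_received.
Qed.

Lemma channel_surj (heta : forall i k l, 0 < eta i k l) (H : channels R K L NB NU) :
  exists g, chan g = H.
Proof.
exists (fun t => let: (i, k, l, a, b, im) := t in
  (if im then complex.Im (H i k l a b) else complex.Re (H i k l a b)) / Num.sqrt (eta i k l)).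
apply/funext => i; apply/funext => k; apply/funext => l; apply/matrixP => a b.
have sq0 : Num.sqrt (eta i k l) != 0 by rewrite gt_eqF // sqrtr_gt0.
rewrite !mxE; case: (H i k l a b) => x y; simpc.
by rewrite !(mulrC (Num.sqrt _)) !divfK.
Qed.

End Rayleigh.

Section AlmostSure.
Variables (R : realType) (d : measure_display) (Omega : measurableType d).
Variables (P : probability Omega R) (K L NB NU ds : nat).
Hypotheses (hK : (1 < K)%N) (hL : (1 < L)%N).
Hypothesis hNB : NB = (((K - 1) * L + 1) * ds)%N.
Hypothesis hNU : NU = (((L - 1) * (K - 1) + 1) * ds)%N.
Variables (eta : 'I_L -> 'I_K -> 'I_K -> R) (heta : forall i k l, 0 < eta i k l).
Variables (G : fading_index K L NB NU -> {RV P >-> R}) (hG : rayleigh_fading G).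

(** The normal law is dominated by Lebesgue measure. *)
Lemma fading_atomless t y : P (G t @^-1` [set y])%classic = 0%E.
Proof.
have -> : P (G t @^-1` [set y])%classic = distribution P (G t) [set y]%classic by [].
rewrite hG.1 //; have /null_content_dominatesP := normal_prob_dominates 0 (Num.sqrt (2^-1 : R)).
by apply => //; exact: lebesgue_measure_set1.
Qed.

Lemma generic_config k : exists H : channels R K L NB NU,
  [/\ forall l, row_free (A_mx H l),
      forall i l (x : 'cV_NU), H i l (ordS l) *m x = 0 -> x = 0
    & forall y : 'rV_NB,
        (forall m l n (v : 'M[R[i]]_(_, n)), A_mx H l *m v = 0 ->
           y *m H m l k *m (T_mx R NU m *m v) = 0) -> y = 0].
Proof.
have [|f [f' [fK f'K]]] := @ord_bij (option ('I_L * 'I_K.-1) * 'I_ds)%type NB.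
  by rewrite card_prod card_option card_prod !card_ord hNB; lia.
have [|h [h' [hK' h'K]]] := @ord_bij (option ('I_L.-1 * 'I_K.-1) * 'I_ds)%type NU.
  by rewrite card_prod card_option card_prod !card_ord hNU; lia.
exists (@config R K L NB NU ds k f h); split=> [l|i l x|y].
- exact: (config_generic_A R hL k fK f'K h'K).
- exact: (config_generic_H f'K hK' h'K).
- exact: (config_generic_rank hL fK f'K hK' h'K).
Qed.

Lemma generic_channels_ae :
  {ae P, forall w, generic_channels (rayleigh_channel eta (fun t => G t w))}.
Proof.
have [_ indG] := hG.
have aeA l : {ae P, forall w, \det (gram_A (rayleigh_channel eta (fun t => G t w)) l) != 0}.
  have [H0 [A0 _ _]] := generic_config l; have [g gH] := channel_surj heta H0.
  apply: (cpolyfun_neq0_ae (f := fun g => \det (gram_A (rayleigh_channel eta g) l)) (g := g)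
    indG fading_atomless).
    exact/cpolyfun_det/mxpolyfun_gram_A.
  by rewrite gH; exact: gram_A_neq0.
have aeH ik : {ae P, forall w,
    \det (gram_H (rayleigh_channel eta (fun t => G t w)) ik.1 ik.2) != 0}.
  have [H0 [_ inj0 _]] := generic_config ik.2; have [g gH] := channel_surj heta H0.
  apply: (cpolyfun_neq0_ae (f := fun g => \det (gram_H (rayleigh_channel eta g) ik.1 ik.2)) (g := g)
    indG fading_atomless).
    exact/cpolyfun_det/mxpolyfun_gram_H.
  by rewrite gH; apply: gram_H_neq0; exact: inj0.
have aeR k : {ae P, forall w,
    \det (gram_received (rayleigh_channel eta (fun t => G t w)) k) != 0}.
  have [H0 [A0 _ inj0]] := generic_config k; have [g gH] := channel_surj heta H0.
  apply: (cpolyfun_neq0_ae (f := fun g => \det (gram_received (rayleigh_channel eta g) k)) (g := g)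
    indG fading_atomless).
    exact/cpolyfun_det/mxpolyfun_gram_received.
  by rewrite gH; exact: gram_received_neq0.
apply: filterS3 (filter_forall _ aeA) (filter_forall _ aeH) (filter_forall _ aeR).
move=> w dA dH dR; apply: generic_of_gram => // i k; exact: (dH (i, k)).
Qed.

End AlmostSure.

(** The argument of the ceiling is already an integer: the fractional parts (L-1)/L d_s and d_s/L
    add up to d_s. *)
Lemma antennas_eq (R : realType) (K L NB NU ds : nat) :
  (1 < K)%N -> (1 < L)%N -> NB = (((K - 1) * L + 1) * ds)%N ->
  NU%:Z = Num.ceil ((L%:R - 1) / L%:R * NB%:R + 1 / L%:R * ds%:R : R) ->
  NU = (((L - 1) * (K - 1) + 1) * ds)%N.
Proof.
case: K => [|k] // _; case: L => [|l] // _ -> hNU.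
suff E : (l.+1%:R - 1) / l.+1%:R * (((k.+1 - 1) * l.+1 + 1) * ds)%N%:R + 1 / l.+1%:R * ds%:R
    = (Posz (((l.+1 - 1) * (k.+1 - 1) + 1) * ds)%N)%:~R :> R.
  by move: hNU; rewrite E intrKceil => -[].
rewrite !subn1 /= -pmulrn !(natrM, natrD) -!natr1.
by field; rewrite natr1 pnatr_eq0.
Qed.

Theorem proposition2 (R : realType) (d : measure_display)
    (Omega : measurableType d) (P : probability Omega R)
    (K L NB NU ds : nat) (hK : (2 <= K)%N) (hL : (2 <= L)%N) (hds : (1 <= ds)%N)
    (hNB : NB = (((K - 1) * L + 1) * ds)%N)
    (hNU : NU%:Z =
       Num.ceil ((L%:R - 1) / L%:R * NB%:R + 1 / L%:R * ds%:R : R))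
    (pw : 'I_L -> 'I_K -> R) (hpw : forall i k, 0 < pw i k)
    (sigma2 : 'I_K -> R) (hsigma2 : forall k, 0 < sigma2 k)
    (eta : 'I_L -> 'I_K -> 'I_K -> R) (heta : forall i k l, 0 < eta i k l)
    (G : fading_index K L NB NU -> {RV P >-> R}) (hG : rayleigh_fading G) :
  {ae P, forall w : Omega,
    let H := rayleigh_channel eta (fun t => G t w) in
    (exists (Vin : 'I_K -> 'M[R[i]]_(\sum_(c < L) NU, ds))
            (Fbar : 'I_K -> 'M[R[i]]_(NB, ds))
            (V : precoders R K L NU ds) (U : decoders R K L NB ds),
       is_closed_form H pw Vin Fbar V U)
    /\ (forall (Vin : 'I_K -> 'M[R[i]]_(\sum_(c < L) NU, ds))
               (Fbar : 'I_K -> 'M[R[i]]_(NB, ds))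
               (V : precoders R K L NU ds) (U : decoders R K L NB ds),
          is_closed_form H pw Vin Fbar V U ->
          [/\ forall i k, gram_in (Vin k) i \in unitmx,
              is_GIA_transceiver H pw V U
            & forall (V' : precoders R K L NU ds) (U' : decoders R K L NB ds),
                is_GIA_transceiver H pw V' U' ->
                forall i k, rate H sigma2 V' U' i k <= rate H sigma2 V U i k])}.
Proof.
have {}hNU := antennas_eq hK hL hNB hNU.
apply: filterS (generic_channels_ae hK hL hNB hNU heta hG) => w genH; split.
  exact: closed_form_exists.
move=> Vin Fbar V U closed.
have [gramU GIA rateE] := closed_form_optimal hK hL hds genH hpw sigma2 closed.
split; [exact: gramU|exact: GIA|move=> V' U' GIA' i k].
by rewrite (rateE V' U' GIA') lexx.
Qed.
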